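(* Let $\mathbb{F}$ be a field, $\sigma$ a sesqui-morphism on $\mathbb{F}$, $G$ a $\sigma$-symmetric $\mathbb{F}^*$-graph, and $X,Y$ disjoint subsets of $V_G$ with $\mathrm{cutrk}_G(X)=\mathrm{cutrk}_G(Y)=k$. The following are equivalent: (1) $\min_{X\subseteq Z\subseteq V_G\setminus Y}\mathrm{cutrk}_G(Z)\ge k$; (2) there exists a $\sigma$-symmetric $\mathbb{F}^*$-graph $G'$ pivot equivalent to $G$ such that $\mathrm{cutrk}_{G'[X\cup Y]}(X)=k$ and, for every pair of subsets $A,B$ with $V_G\setminus Y\subseteq A$ and $B\subseteq V_G\setminus A$, $\mathrm{cutrk}_{G'[A\cup B]}(A)=\mathrm{cutrk}_{G[A\cup B]}(A)$; (3) there exists a sequence of pairs $(a_1,b_1),\dots,(a_m,b_m)$ of vertices in $V_G\setminus Y$ (such that the successive pivot complementations are defined) with $\mathrm{cutrk}_{(G\wedge a_1b_1\wedge a_2b_2\cdots\wedge a_mb_m)[X\cup Y]}(X)=k$.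
   Context: A sesqui-morphism on a field $\mathbb{F}$ is a bijection $\sigma:\mathbb{F}\to\mathbb{F}$ with $\sigma(\sigma(a))=a$ such that $a\mapsto\sigma(a)/\sigma(1)$ is a field automorphism. An $\mathbb{F}^*$-graph $G$ is a finite loopless graph on $V_G$ with adjacency matrix $M_G$ over $\mathbb{F}$, $M_G[x,x]=0$, $M_G[x,y]\ne0$ iff $xy$ is an edge; it is $\sigma$-symmetric if $M_G[x,y]=\sigma(M_G[y,x])$ for all $x,y$. For $x,y$ with $M_G[x,y]\ne0$, $G\wedge xy$ is the $\mathbb{F}^*$-graph on $V_G$ with matrix $M'$: $M'[z,z]=0$; for distinct $s,t\notin\{x,y\}$, $M'[s,t]=M_G[s,t]-\frac{M_G[s,x]M_G[y,t]}{M_G[y,x]}-\frac{M_G[s,y]M_G[x,t]}{M_G[x,y]}$; for $s,t\notin\{x,y\}$, $M'[x,t]=\frac{M_G[y,t]}{M_G[y,x]}$, $M'[y,t]=\frac{\sigma(1)M_G[x,t]}{M_G[x,y]}$, $M'[s,x]=\frac{\sigma(1)M_G[s,y]}{M_G[x,y]}$, $M'[s,y]=\frac{M_G[s,x]}{M_G[y,x]}$; $M'[x,y]=-\frac{1}{M_G[y,x]}$, $M'[y,x]=-\frac{\sigma(1)^2}{M_G[x,y]}$. Pivot equivalent means obtained by a sequence of pivot complementations. $G[S]$ is the induced $\mathbb{F}^*$-graph on $S$ with matrix $M_G[S]$. $\mathrm{cutrk}_G(X)=\mathrm{rank}_{\mathbb{F}}M_G[X,V_G\setminus X]$ (0 if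 $X$ or $V_G\setminus X$ is empty). *)

(* Defs.v *)
From HB Require Import structures.
From mathcomp Require Import all_boot all_order all_algebra.
Set Implicit Arguments.
Unset Strict Implicit.
Unset Printing Implicit Defensive.
Import GRing.Theory.
Local Open Scope ring_scope.

Definition sesqui_morphism (F : fieldType) (sigma : F -> F) : Prop :=
  [/\ bijective sigma,
      forall a, sigma (sigma a) = a
    & exists2 tau : {rmorphism F -> F},
        bijective tau & forall a, tau a = sigma a / sigma 1].

(* The underlying graph is determined by the matrix: xy is an edge exactly when
   the entry at (x, y) is nonzero. *)
Record star_graph (F : fieldType) (V : finType) := StarGraph {
  adj :> V -> V -> F;
  adj_diag : forall x, adj x x = 0
}.

Definition edge (F : fieldType) (V : finType) (G : star_graph F V) : rel V :=
  fun x y => G x y != 0.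

Definition sigma_symmetric (F : fieldType) (sigma : F -> F) (V : finType)
    (G : star_graph F V) : Prop :=
  forall x y, G x y = sigma (G y x).

Section Pivot.

Variables (F : fieldType) (sigma : F -> F) (V : finType).
Implicit Types G : star_graph F V.

(* Only meaningful when xy is an edge (hence x != y), with G x y and G y x both
   nonzero; the latter follows from the former in a sigma-symmetric graph. *)
Definition pivot_adj G (x y s t : V) : F :=
  if s == t then 0
  else if s == x then
    if t == y then - (1 / G y x) else G y t / G y x
  else if s == y then
    if t == x then - (sigma 1 ^+ 2 / G x y) else sigma 1 * G x t / G x y
  else if t == x then sigma 1 * G s y / G x y
  else if t == y then G s x / G y x
  else G s t - G s x * G y t / G y x - G s y * G x t / G x y.

Lemma pivot_adj_diag G x y z : pivot_adj G x y z z = 0.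
Proof. by rewrite /pivot_adj eqxx. Qed.

Definition pivot G x y : star_graph F V := StarGraph (pivot_adj_diag G x y).

Fixpoint pivots G (p : seq (V * V)) : star_graph F V :=
  if p is (a, b) :: p' then pivots (pivot G a b) p' else G.

Fixpoint pivots_defined G (p : seq (V * V)) : bool :=
  if p is (a, b) :: p' then edge G a b && pivots_defined (pivot G a b) p'
  else true.

(* G' is obtained from G. *)
Definition pivot_equivalent G' G : Prop :=
  exists2 p, pivots_defined G p & G' = pivots G p.

End Pivot.

Section Cutrank.

Variables (F : fieldType) (V : finType) (G : star_graph F V).

Definition adj_submx (A B : {set V}) : 'M[F]_(#|A|, #|B|) :=
  \matrix_(i, j) G (enum_val i) (enum_val j).

Definition cutrk (X : {set V}) : nat := \rank (adj_submx X (~: X)).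

Definition induced (S : {set V}) : star_graph F {x : V | x \in S} :=
  @StarGraph F {x : V | x \in S} (fun u v => G (val u) (val v))
    (fun u => adj_diag G (val u)).

End Cutrank.

(* The cut-rank of A in G[S], for A a subset of S. *)
Definition cutrk_in (F : fieldType) (V : finType) (G : star_graph F V)
    (S A : {set V}) : nat :=
  cutrk (induced G S) [set u | val u \in A].

(* Main.v *)
(* Write r(A, B) for the rank of M[A, B]. Row operations and Schur complements show
   that pivoting at vw preserves r(A, B) when A, B are disjoint and v, w lie in their
   union, and that r'(A, B) + 1 = r(A + v, B + v) after the pivot when v lies
   outside; zeroing the diagonal in a pivot is harmless because r only sees
   off-diagonal blocks. With submodularity of r this gives Tutte's linking theorem:
   every vertex v outside X and Y can be deleted, possibly after pivoting at an edge
   vw, without destroying the connectivity between X and Y. One may take w outside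
   Y, for if v has no such neighbour then deleting v is harmless. Such pivots do not
   change cut-ranks of sets containing the complement of Y. *)

Require Import Defs.
From mathcomp Require Import all_boot all_order all_algebra.
From mathcomp Require Import ring.

Set Implicit Arguments.
Unset Strict Implicit.
Unset Printing Implicit Defensive.
Import GRing.Theory.

(** * Matrix rank under zero padding and elimination *)

Section MatrixRank.

Local Open Scope ring_scope.
Variable F : fieldType.

(** [N] factors as [L *m M *m R] with 0/1 selection matrices. An index sent to [None] gives a zero
    row or column, so taking submatrices and padding with zeros are covered at once. *)
Lemma mxrank_partial_mxsub m n p q (M : 'M[F]_(m, n)) (N : 'M[F]_(p, q))
    (phi : 'I_p -> option 'I_m) (psi : 'I_q -> option 'I_n) :
  (forall i j, N i j = if phi i is Some i' then
                         if psi j is Some j' then M i' j' else 0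
                       else 0) ->
  (\rank N <= \rank M)%N.
Proof.
move=> Ndef.
pose L : 'M[F]_(p, m) := \matrix_(i, k) (phi i == Some k)%:R.
pose R : 'M[F]_(n, q) := \matrix_(l, j) (psi j == Some l)%:R.
have -> : N = L *m M *m R.
  apply/matrixP => i j; rewrite Ndef mxE.
  case psij: (psi j) => [j'|]; last first.
    rewrite big1; first by case: (phi i).
    by move=> l _; rewrite [R _ _]mxE psij mulr0.
  rewrite (bigD1 j') //= [R _ _]mxE psij eqxx mulr1 big1 ?addr0; last first.
    by move=> l /negPf nl; rewrite [R _ _]mxE psij (inj_eq Some_inj) eq_sym nl mulr0.
  rewrite mxE; case phii: (phi i) => [i'|]; last first.
    by rewrite big1 // => k _; rewrite mxE phii mul0r.
  rewrite (bigD1 i') //= mxE phii eqxx mul1r big1 ?addr0 // => k /negPf nk.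
  by rewrite mxE phii (inj_eq Some_inj) eq_sym nk mul0r.
by apply: leq_trans (mxrankM_maxl _ _) (mxrankM_maxr _ _).
Qed.

(** Rank-nullity for multiplication by the basis vector [e]: the image is the nonzero column [j], of
    rank one, and the row space of the Schur complement is the part of the row space of [M]
    annihilated by [e]. *)
Lemma mxrank_schur m n (M : 'M[F]_(m, n)) (i : 'I_m) (j : 'I_n) :
  M i j != 0 ->
  \rank M = (\rank (M - (M i j)^-1 *: (col j M *m row i M))).+1.
Proof.
move=> Mij; set N := (M - _).
pose e : 'cV[F]_n := delta_mx j 0.
have Me : M *m e = col j M by rewrite colE.
have NE : N = (1%:M - (M i j)^-1 *: (col j M *m delta_mx 0 i)) *m M.
  by rewrite mulmxBl mul1mx -scalemxAl -mulmxA -rowE.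
have Ne : N *m e = 0.
  rewrite mulmxBl -scalemxAl -mulmxA Me -row_mul Me.
  apply/matrixP => s z; rewrite !mxE big_ord1 !mxE.
  by rewrite mulrC mulfK ?subrr.
rewrite -(mxrank_mul_ker M e) -[RHS]add1n; congr (_ + _)%N.
  apply/eqP; rewrite eqn_leq rank_leq_col lt0n mxrank_eq0 Me.
  by apply: contraNneq Mij => /matrixP/(_ i 0); rewrite !mxE => ->.
apply/eqP; rewrite eqn_leq; apply/andP; split; apply: mxrankS; last first.
  rewrite sub_capmx; apply/andP; split; first by rewrite NE submxMl.
  by apply/sub_kermxP.
(* The coefficients [D] annihilate column [j], so the correction term drops out and
   [D *m M = D *m N]. *)
have /submxP[D DE] : (M :&: kermx e <= M)%MS by apply: capmxSl.
have : (M :&: kermx e)%MS *m e = 0 by apply/sub_kermxP/capmxSr.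
rewrite DE -mulmxA Me => D0.
have -> : D *m M = D *m N.
  by rewrite mulmxBr -scalemxAr [D *m (_ *m _)]mulmxA D0 mul0mx scaler0 subr0.
exact: submxMl.
Qed.

End MatrixRank.

(** * Ranks of blocks indexed by vertex sets *)

Section SetRank.

Local Open Scope ring_scope.
Variables (F : fieldType) (V : finType).
Implicit Types (f g : V -> V -> F) (A B C D : {set V}).

(* Padding [f[A, B]] with zeros to a fixed size makes submatrices over different
   index sets comparable. *)
Definition padmx f A B : 'M[F]_#|V| :=
  \matrix_(i, j) if (enum_val i \in A) && (enum_val j \in B)
                 then f (enum_val i) (enum_val j) else 0.

Definition rk f A B : nat := \rank (padmx f A B).

(** For [s] in [A] these rows span the row space of [padmx f A B], so row operations reduce to the
    membership of single rows. *)
Definition padrow f B s : 'rV[F]_#|V| :=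
  \row_j if enum_val j \in B then f s (enum_val j) else 0.

Lemma eq_rk f g A B : {in A & B, forall s t, f s t = g s t} ->
  rk f A B = rk g A B.
Proof.
move=> fg; congr (\rank _); apply/matrixP => i j; rewrite !mxE.
by case: ifP => // /andP[iA jB]; apply: fg.
Qed.

Lemma rk_tr f A B : rk (fun s t => f t s) B A = rk f A B.
Proof.
rewrite /rk -mxrank_tr; congr (\rank _).
by apply/matrixP => i j; rewrite !mxE andbC.
Qed.

Lemma padrow_sub f A B s : s \in A -> (padrow f B s <= padmx f A B)%MS.
Proof.
move=> sA; apply: (eq_row_sub (enum_rank s)).
by apply/rowP => j; rewrite !mxE enum_rankK sA.
Qed.

Lemma padmx_sub f A B m (W : 'M[F]_(m, #|V|)) :
  (forall s, s \in A -> (padrow f B s <= W)%MS) -> (padmx f A B <= W)%MS.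
Proof.
move=> fW; apply/row_subP => i.
have [iA|iA] := boolP (enum_val i \in A).
  apply: submx_trans (fW _ iA); rewrite (_ : row i _ = padrow f B (enum_val i)) //.
  by apply/rowP => j; rewrite !mxE iA.
rewrite (_ : row i _ = 0) ?sub0mx //.
by apply/rowP => j; rewrite !mxE (negPf iA).
Qed.

(** Bridge between matrices enumerated by a set, as in the definition of cut-rank, and padded ones;
    [h] is later the identity or the inclusion of an induced vertex set. *)
Lemma rk_imset (W : finType) (h : W -> V) f (A B : {set W}) :
  injective h ->
  \rank (\matrix_(i < #|A|, j < #|B|) f (h (enum_val i)) (h (enum_val j)))
    = rk f (h @: A) (h @: B).
Proof.
move=> h_inj; apply/eqP; rewrite eqn_leq; apply/andP; split.
  apply: (@mxrank_partial_mxsub _ _ _ _ _ _ _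
    (fun i => Some (enum_rank (h (enum_val i))))
    (fun j => Some (enum_rank (h (enum_val j))))) => i j.
  by rewrite !mxE !enum_rankK !imset_f // enum_valP.
pose phi (E : {set W}) (i : 'I_#|V|) :=
  [pick k : 'I_#|E| | h (enum_val k) == enum_val i].
have phiP E i : if phi E i is Some k then h (enum_val k) = enum_val i
                else enum_val i \notin h @: E.
  rewrite /phi; case: pickP => [k /eqP //|nk].
  apply/imsetP => -[w wE iw].
  by have := nk (enum_rank_in wE w); rewrite enum_rankK_in // iw eqxx.
apply: (@mxrank_partial_mxsub _ _ _ _ _ _ _ (phi A) (phi B)) => i j.
rewrite mxE; have := phiP A i; have := phiP B j.
case: (phi A i) => [k|]; last by move=> _ /negPf ->.
case: (phi B j) => [l|]; last by move=> /negPf -> _; rewrite andbF.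
by move=> <- <-; rewrite mxE !imset_f // enum_valP.
Qed.

Lemma rk_scale_le f g A B (d e : V -> F) :
  (forall s t, f s t = d s * g s t * e t) -> (rk f A B <= rk g A B)%N.
Proof.
move=> fE; rewrite /rk (_ : padmx f A B = diag_mx (\row_i d (enum_val i)) *m
  padmx g A B *m diag_mx (\row_i e (enum_val i))).
  exact: leq_trans (mxrankM_maxl _ _) (mxrankM_maxr _ _).
apply/matrixP => i j; rewrite mul_mx_diag mxE [in RHS]mxE mul_diag_mx !mxE.
by case: ifP => // _; rewrite mulr0 mul0r.
Qed.

Lemma rkS f A B C D : A \subset C -> B \subset D -> (rk f A B <= rk f C D)%N.
Proof.
move=> /subsetP AC /subsetP BD.
apply: (@mxrank_partial_mxsub _ _ _ _ _ _ _
  (fun i => if enum_val i \in A then Some i else None)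
  (fun j => if enum_val j \in B then Some j else None)) => i j.
rewrite mxE; case iA: (_ \in A) => //=; case jB: (_ \in B) => //=.
by rewrite mxE AC ?BD.
Qed.

(** Row [a] and column [b] of the Schur complement vanish, so both can leave the index sets. *)
Lemma rk_schur f A B a b : a \in A -> b \in B -> f a b != 0 ->
  rk f A B =
  (rk (fun s t => f s t - f s b * f a t / f a b) (A :\ a) (B :\ b)).+1.
Proof.
move=> aA bB fab.
rewrite /rk (@mxrank_schur _ _ _ _ (enum_rank a) (enum_rank b)); last first.
  by rewrite mxE !enum_rankK aA bB.
congr (\rank _).+1; apply/matrixP => i j.
rewrite !mxE big_ord1 !mxE !enum_rankK aA bB !inE /= andbT.
move: (enum_val i) (enum_val j) => s t.
case: (s \in A); case: (t \in B);
  rewrite /= ?andbF ?andbT /= ?mul0r ?mulr0 ?subr0 //.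
case: eqP => [->|_] /=; first by field.
by case: eqP => [->|_] /=; field.
Qed.

(** * Coordinate subspaces and submodularity of the rank *)

Definition proj_mx_on B : 'M[F]_#|V| := diag_mx (\row_i (enum_val i \in B)%:R).

Lemma proj_mx_onM B C : proj_mx_on B *m proj_mx_on C = proj_mx_on (B :&: C).
Proof.
rewrite /proj_mx_on mulmx_diag; congr diag_mx; apply/rowP => i.
by rewrite !mxE inE -natrM mulnb.
Qed.

Lemma proj_mx_onC B : proj_mx_on B + proj_mx_on (~: B) = 1%:M.
Proof.
apply/matrixP => i j; rewrite !mxE !inE -mulrnDl.
by case: (_ \in B); rewrite ?addr0 ?add0r.
Qed.

Lemma padmxE f A B :
  padmx f A B = proj_mx_on A *m padmx f setT setT *m proj_mx_on B.
Proof.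
apply/matrixP => i j; rewrite mul_mx_diag mxE [in RHS]mxE mul_diag_mx !mxE !inE.
by case: (_ \in A); case: (_ \in B); rewrite /= ?mul1r ?mulr1 ?mul0r ?mulr0.
Qed.

Lemma proj_mx_onS B C : B \subset C -> (proj_mx_on B <= proj_mx_on C)%MS.
Proof. by move=> /setIidPl <-; rewrite -proj_mx_onM submxMl. Qed.

Lemma proj_mx_on_cap B C :
  (proj_mx_on B :&: proj_mx_on C :=: proj_mx_on (B :&: C))%MS.
Proof.
apply/eqmxP/andP; split; last first.
  by rewrite sub_capmx !proj_mx_onS ?subsetIl ?subsetIr.
have id (E : {set V}) (W : 'M[F]_#|V|) : (W <= proj_mx_on E)%MS -> W *m proj_mx_on E = W.
  by case/submxP => Z ->; rewrite -mulmxA proj_mx_onM setIid.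
rewrite -{1}(id C _ (capmxSr _ _)) -{1}(id B _ (capmxSl _ _)) -mulmxA proj_mx_onM.
exact: submxMl.
Qed.

Lemma proj_mx_on_sum B C :
  (proj_mx_on B + proj_mx_on C :=: proj_mx_on (B :|: C))%MS.
Proof.
apply/eqmxP/andP; split.
  by rewrite addsmx_sub !proj_mx_onS ?subsetUl ?subsetUr.
have -> : proj_mx_on (B :|: C) = proj_mx_on B + proj_mx_on (~: B) *m proj_mx_on C.
  rewrite proj_mx_onM; apply/matrixP => i j; rewrite !mxE !inE -mulrnDl.
  by case: (_ \in B); case: (_ \in C); rewrite ?addr0 ?add0r.
exact: addmx_sub_adds (submx_refl _) (submxMl _ _).
Qed.

(* The row space of [f[A, V]] enlarged by all vectors vanishing on [B]: its
   dimension is [rk f A B] plus a modular function of [B]. *)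
Definition rkspace f A B : 'M[F]_#|V| :=
  (proj_mx_on A *m padmx f setT setT + proj_mx_on (~: B))%MS.

(** Rank-nullity for the projection onto [B]: the image of [rkspace f A B] is the row space of
    [padmx f A B], the kernel part consists of all vectors supported off [B]. *)
Lemma mxrank_rkspace f A B :
  \rank (rkspace f A B) = (rk f A B + \rank (proj_mx_on (~: B)))%N.
Proof.
have prCB : proj_mx_on (~: B) *m proj_mx_on B = 0.
  rewrite proj_mx_onM setIC setICr; apply/matrixP => i j.
  by rewrite !mxE inE mul0rn.
rewrite -(mxrank_mul_ker _ (proj_mx_on B)); congr (_ + _)%N.
  by rewrite /rkspace addsmxMr prCB addsmx0 /rk (padmxE f A B).
apply/eqmx_rank/andP; split; last first.
  by rewrite sub_capmx addsmxSr /=; apply/sub_kermxP.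
apply: submx_trans (capmxSr _ _) _.
rewrite -[kermx _]mulmx1 -(proj_mx_onC B) mulmxDr (sub_kermxP (submx_refl _)) add0r.
exact: submxMl.
Qed.

(** The two spaces attached to the left-hand side lie in the intersection and in the sum of those
    attached to the right-hand side. The dimension formula applies to the latter, and the coordinate
    terms cancel by the same formula. *)
Lemma rk_submod f A B C D :
  (rk f (A :&: C) (B :|: D) + rk f (A :|: C) (B :&: D)
    <= rk f A B + rk f C D)%N.
Proof.
have := mxrank_sum_cap (rkspace f A B) (rkspace f C D).
have := mxrank_sum_cap (proj_mx_on (~: B)) (proj_mx_on (~: D)).
rewrite proj_mx_on_sum proj_mx_on_cap -setCI -setCU => prE.
rewrite !mxrank_rkspace => spE.
have capS : (\rank (rkspace f (A :&: C) (B :|: D)) <=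
             \rank (rkspace f A B :&: rkspace f C D)%MS)%N.
  apply: mxrankS; rewrite sub_capmx /rkspace.
  by rewrite !addsmxS ?proj_mx_onS ?submxMr ?proj_mx_onS ?setCS ?subsetUl
    ?subsetUr ?subsetIl ?subsetIr.
have sumS : (\rank (rkspace f (A :|: C) (B :&: D)) <=
             \rank (rkspace f A B + rkspace f C D)%MS)%N.
  apply: mxrankS; rewrite /rkspace setCI addsmx_sub; apply/andP; split.
    rewrite -(eqmxMr _ (proj_mx_on_sum A C)) addsmxMr.
    by rewrite addsmxS ?addsmxSl.
  by rewrite -proj_mx_on_sum addsmxS ?addsmxSr.
move: capS sumS; rewrite !mxrank_rkspace => capS sumS.
rewrite -(leq_add2r (\rank (proj_mx_on (~: (B :&: D)))
                      + \rank (proj_mx_on (~: (B :|: D)))))%N.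
rewrite [in leqRHS]prE [leqRHS]addnACA -spE (addnC (rk f (A :&: C) _)).
by rewrite [leqLHS]addnACA leq_add.
Qed.

End SetRank.

(** * Effect of a pivot on the ranks of off-diagonal blocks *)

Section PivotRank.

Local Open Scope ring_scope.
Variables (F : fieldType) (sigma : F -> F) (V : finType).
Hypothesis sigma1 : sigma 1 != 0.
Implicit Types (G : star_graph F V) (x y s t v w : V) (A B : {set V}).

Definition tr_graph G : star_graph F V :=
  @StarGraph F V (fun s t => G t s) (adj_diag G).

Lemma edge_neq G x y : G x y != 0 -> x != y.
Proof. by apply: contraNneq => ->; rewrite adj_diag. Qed.

Lemma disjoint_neq A B s t : [disjoint A & B] -> s \in A -> t \in B -> s != t.
Proof. by move=> dAB sA; apply: contraTneq => <-; rewrite (disjointFr dAB). Qed.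

(** Transposition exchanges the two ends of the pivot, which reduces claims about columns to claims
    about rows. *)
Lemma pivot_tr G x y s t : G x y != 0 ->
  pivot sigma (tr_graph G) y x s t = pivot sigma G x y t s.
Proof.
move=> Gxy; have nxy := edge_neq Gxy.
rewrite /= /pivot_adj /= (eq_sym t s).
have [//|nst] := eqVneq s t.
have [sy|sy] := eqVneq s y; have [sx|sx] := eqVneq s x;
  have [ty|ty] := eqVneq t y; have [tx|tx] := eqVneq t x;
  move: nxy nst; subst; rewrite ?eqxx //= => _ _; by ring.
Qed.

Section FixedEdge.

Variables (G : star_graph F V) (x y : V).
Hypotheses (Gxy : G x y != 0) (Gyx : G y x != 0).

Let G' := pivot sigma G x y.

Let nxy : x != y := edge_neq Gxy.
Let nyx : y != x := edge_neq Gyx.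

Lemma pivot_xy : G' x y = - (1 / G y x).
Proof. by rewrite /= /pivot_adj (negPf nxy) !eqxx. Qed.

Lemma pivot_yx : G' y x = - (sigma 1 ^+ 2 / G x y).
Proof. by rewrite /= /pivot_adj (negPf nyx) !eqxx. Qed.

Lemma pivot_xl t : t != x -> t != y -> G' x t = G y t / G y x.
Proof. by move=> tx ty; rewrite /= /pivot_adj eq_sym (negPf tx) eqxx (negPf ty). Qed.

Lemma pivot_yl t : t != x -> t != y -> G' y t = sigma 1 * G x t / G x y.
Proof.
by move=> tx ty; rewrite /= /pivot_adj eq_sym (negPf ty) (negPf nyx) eqxx (negPf tx).
Qed.

Lemma pivot_xr s : s != x -> s != y -> G' s x = sigma 1 * G s y / G x y.
Proof. by move=> sx sy; rewrite /= /pivot_adj (negPf sx) (negPf sy) eqxx. Qed.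

Lemma pivot_yr s : s != x -> s != y -> G' s y = G s x / G y x.
Proof.
by move=> sx sy; rewrite /= /pivot_adj (negPf sx) (negPf sy) eqxx (negPf nyx).
Qed.

Lemma pivot_out s t : s != t -> s != x -> s != y -> t != x -> t != y ->
  G' s t = G s t - G s x * G y t / G y x - G s y * G x t / G x y.
Proof.
by move=> st sx sy tx ty; rewrite /= /pivot_adj (negPf st) (negPf sx) (negPf sy)
  (negPf tx) (negPf ty).
Qed.

(** The row spaces agree: the new rows [x] and [y] are nonzero multiples of the old rows [y] and
    [x], and every other row changes by a combination of these two. *)
Lemma rk_pivot_sub A B : [disjoint A & B] -> x \in A -> y \in A ->
  rk G' A B = rk G A B.
Proof.
move=> dAB xA yA.
have neq s t : s \in A -> t \in B -> t != s.
  by move=> sA tB; rewrite eq_sym (disjoint_neq dAB).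
apply/eqmx_rank/andP; split; apply: padmx_sub => s sA.
- have [->|sx] := eqVneq s x.
    rewrite (_ : padrow _ _ _ = (G y x)^-1 *: padrow G B y).
      by rewrite scalemx_sub ?padrow_sub.
    apply/rowP => j; rewrite !mxE; case: ifP => jB; last by rewrite mulr0.
    by rewrite pivot_xl ?neq // mulrC.
  have [->|sy] := eqVneq s y.
    rewrite (_ : padrow _ _ _ = (sigma 1 / G x y) *: padrow G B x).
      by rewrite scalemx_sub ?padrow_sub.
    apply/rowP => j; rewrite !mxE; case: ifP => jB; last by rewrite mulr0.
    by rewrite pivot_yl ?neq // mulrAC.
  rewrite (_ : padrow _ _ _ = padrow G B s - (G s x / G y x) *: padrow G B y
                              - (G s y / G x y) *: padrow G B x).
    by rewrite !addmx_sub ?eqmx_opp ?scalemx_sub ?padrow_sub.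
  apply/rowP => j; rewrite !mxE; case: ifP => jB; last by rewrite !mulr0 !subr0.
  by rewrite pivot_out ?(disjoint_neq dAB sA jB) // ?neq //; field; rewrite Gxy Gyx.
- have Gx : (padrow G B y <= padmx G' A B)%MS.
    rewrite (_ : padrow _ _ _ = G y x *: padrow G' B x).
      by rewrite scalemx_sub ?padrow_sub.
    apply/rowP => j; rewrite !mxE; case: ifP => jB; last by rewrite mulr0.
    by rewrite pivot_xl ?neq // mulrC divfK.
  have Gy : (padrow G B x <= padmx G' A B)%MS.
    rewrite (_ : padrow _ _ _ = (G x y / sigma 1) *: padrow G' B y).
      by rewrite scalemx_sub ?padrow_sub.
    apply/rowP => j; rewrite !mxE; case: ifP => jB; last by rewrite mulr0.
    by rewrite pivot_yl ?neq //; field; rewrite Gxy sigma1.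
  have [->//|sx] := eqVneq s x.
  have [->//|sy] := eqVneq s y.
  rewrite (_ : padrow _ _ _ = padrow G' B s + (G s x / G y x) *: padrow G B y
                              + (G s y / G x y) *: padrow G B x).
    by rewrite !addmx_sub ?scalemx_sub ?padrow_sub.
  apply/rowP => j; rewrite !mxE; case: ifP => jB; last by rewrite !mulr0 !addr0.
  by rewrite pivot_out ?(disjoint_neq dAB sA jB) // ?neq //; field; rewrite Gxy Gyx.
Qed.

(** Eliminating the entry at [(x, y)] before and after the pivot leaves the same Schur
    complement. *)
Lemma rk_pivot_cross_xy A B : [disjoint A & B] -> x \in A -> y \in B ->
  rk G' A B = rk G A B.
Proof.
move=> dAB xA yB.
rewrite (@rk_schur _ _ G A B x y) // (@rk_schur _ _ G' A B x y) //; last first.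
  by rewrite pivot_xy oppr_eq0 mul1r invr_eq0.
congr _.+1; apply: eq_rk => s t; rewrite !inE => /andP[sx sA] /andP[ty tB].
have st := disjoint_neq dAB sA tB; have sy := disjoint_neq dAB sA yB.
have tx : t != x by rewrite eq_sym (disjoint_neq dAB).
rewrite pivot_out // pivot_yr // pivot_xl // pivot_xy.
by field; rewrite Gxy Gyx oppr_eq0 oner_eq0.
Qed.

Lemma rk_pivot_cross_yx A B : [disjoint A & B] -> y \in A -> x \in B ->
  rk G' A B = rk G A B.
Proof.
move=> dAB yA xB.
rewrite (@rk_schur _ _ G A B y x) // (@rk_schur _ _ G' A B y x) //; last first.
  by rewrite pivot_yx oppr_eq0 mulf_neq0 ?invr_eq0 // expf_neq0.
congr _.+1; apply: eq_rk => s t; rewrite !inE => /andP[sy sA] /andP[tx tB].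
have st := disjoint_neq dAB sA tB; have sx := disjoint_neq dAB sA xB.
have ty : t != y by rewrite eq_sym (disjoint_neq dAB).
rewrite pivot_out // pivot_xr // pivot_yl // pivot_yx.
by field; rewrite Gxy Gyx oppr_eq0 expf_neq0.
Qed.

(* Up to row operations, [G'[A, B]] is the Schur complement of the entry [G y x];
   the row [x] of this complement needs no correction because [G x x = 0]. *)
Lemma rk_pivot_del_row A B : [disjoint A & B] -> x \notin A -> x \notin B ->
  y \in A -> rk G (x |: A) (x |: B) = (rk G' A B).+1.
Proof.
move=> dAB xA xB yA.
rewrite (@rk_schur _ _ G _ _ y x) ?setU11 ?setU1r //; congr _.+1.
set g := fun s t => _.
rewrite [(x |: B) :\ x]setU1K //.
have neq s t : s \in A -> t \in B -> t != s.
  by move=> sA tB; rewrite eq_sym (disjoint_neq dAB).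
have nx t : t \in B -> t != x by apply: contraTneq => ->.
have gx : padrow g B x = (G x y / sigma 1) *: padrow G' B y.
  apply/rowP => j; rewrite !mxE; case: ifP => jB; last by rewrite mulr0.
  rewrite pivot_yl ?nx // ?neq // /g adj_diag.
  by field; rewrite Gxy Gyx sigma1.
(* The pivot also subtracts [G s y * G x t / G x y]; this multiple of the pivoted row [y] adds it
   back. *)
have gs s : s \in A -> s != y ->
    padrow g B s = padrow G' B s + (G s y / sigma 1) *: padrow G' B y.
  move=> sA sy; apply/rowP => j; rewrite !mxE.
  case: ifP => jB; last by rewrite mulr0 addr0.
  have sx : s != x by apply: contraNneq xA => <-.
  rewrite pivot_yl ?nx // ?neq // pivot_out ?(disjoint_neq dAB sA jB) // ?nx // ?neq // /g.
  by field; rewrite Gxy Gyx sigma1.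
apply/eqmx_rank/andP; split; apply: padmx_sub => s.
- rewrite !inE => /andP[sy /predU1P[->|sA]].
    by rewrite gx scalemx_sub ?padrow_sub.
  by rewrite gs // addmx_sub ?scalemx_sub ?padrow_sub.
- move=> sA.
  have Gy : (padrow G' B y <= padmx g ((x |: A) :\ y) B)%MS.
    rewrite (_ : padrow _ _ _ = (sigma 1 / G x y) *: padrow g B x).
      by rewrite scalemx_sub ?padrow_sub // !inE eqxx nxy.
    rewrite gx scalerA (_ : _ * _ = 1) ?scale1r //.
    by field; rewrite Gxy sigma1.
  have [->//|sy] := eqVneq s y.
  have -> : padrow G' B s = padrow g B s - (G s y / sigma 1) *: padrow G' B y.
    by rewrite gs // addrK.
  by rewrite addmx_sub ?eqmx_opp ?scalemx_sub ?padrow_sub // !inE sy sA orbT.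
Qed.

End FixedEdge.

(** The two orientations are conjugate by the diagonal matrix with [sigma 1] at [x], its inverse at
    [y] and 1 elsewhere. *)
Lemma rk_pivotC G x y A B : G x y != 0 -> G y x != 0 ->
  rk (pivot sigma G y x) A B = rk (pivot sigma G x y) A B.
Proof.
move=> Gxy Gyx; have nxy := edge_neq Gxy.
pose d s := if s == x then sigma 1 else if s == y then (sigma 1)^-1 else 1.
have d0 s : d s != 0.
  by rewrite /d; case: ifP => // _; case: ifP; rewrite ?invr_eq0 ?oner_eq0.
have pivotC s t : pivot sigma G y x s t = d s * pivot sigma G x y s t * (d t)^-1.
  rewrite /= /pivot_adj /d.
  have [st|nst] := eqVneq s t; first by rewrite mulr0 mul0r.
  have [sy|sy] := eqVneq s y; have [sx|sx] := eqVneq s x;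
    have [ty|ty] := eqVneq t y; have [tx|tx] := eqVneq t x;
    move: nxy nst; subst; rewrite ?eqxx //= => _ _;
    by field; rewrite ?Gxy ?Gyx ?sigma1 ?oner_eq0.
apply/eqP; rewrite eqn_leq; apply/andP; split.
  exact: (@rk_scale_le _ _ _ _ A B d (fun t => (d t)^-1)).
apply: (@rk_scale_le _ _ _ _ A B (fun s => (d s)^-1) d) => s t.
by rewrite pivotC -mulrA mulfVK ?mulKf.
Qed.

Lemma rk_pivot G x y A B : G x y != 0 -> G y x != 0 -> [disjoint A & B] ->
  x \in A :|: B -> y \in A :|: B -> rk (pivot sigma G x y) A B = rk G A B.
Proof.
move=> Gxy Gyx dAB; rewrite !inE => /orP[xA|xB] /orP[yA|yB].
- exact: rk_pivot_sub.
- exact: rk_pivot_cross_xy.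
- exact: rk_pivot_cross_yx.
rewrite -rk_tr -[RHS]rk_tr -(@rk_pivot_sub (tr_graph G) y x) // 1?disjoint_sym //.
by apply: eq_rk => s t _ _; rewrite -pivot_tr.
Qed.

Lemma rk_pivot_del G v w A B : G v w != 0 -> G w v != 0 -> [disjoint A & B] ->
  v \notin A :|: B -> w \in A :|: B ->
  rk G (v |: A) (v |: B) = (rk (pivot sigma G v w) A B).+1.
Proof.
move=> Gvw Gwv dAB; rewrite !inE negb_or => /andP[vA vB] /orP[wA|wB].
  exact: rk_pivot_del_row.
(* Transposing yields the pivot with its ends exchanged; [rk_pivotC] restores the orientation. *)
rewrite -rk_tr (@rk_pivot_del_row (tr_graph G) v w) // 1?disjoint_sym //.
rewrite -rk_pivotC // -[in RHS]rk_tr; congr _.+1.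
by apply: eq_rk => s t _ _; rewrite -pivot_tr.
Qed.

End PivotRank.

(** * Sigma-symmetry under pivoting, and the linking argument *)

Section Sesqui.

Local Open Scope ring_scope.
Variables (F : fieldType) (sigma : F -> F) (V : finType).
Hypothesis sigmaP : sesqui_morphism sigma.
Implicit Types (G : star_graph F V) (X Y S Z A B : {set V}).

Lemma sesqui1_neq0 : sigma 1 != 0.
Proof.
case: sigmaP => _ _ [tau _ tauE]; apply/eqP => s1.
by have := oner_neq0 F; rewrite -(rmorph1 tau) tauE s1 mul0r eqxx.
Qed.

Lemma sigma_symmetric_neq0 G x y :
  sigma_symmetric sigma G -> G x y != 0 -> G y x != 0.
Proof.
move=> Gsym; apply: contraNneq => Gyx; rewrite Gsym Gyx.
case: sigmaP => _ _ [tau _ tauE].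
have /eqP := tauE 0.
by rewrite rmorph0 eq_sym mulf_eq0 invr_eq0 (negPf sesqui1_neq0) orbF.
Qed.

(** Writing [sigma a] as [sigma 1 * tau a] turns each entry into a field identity; the involution
    gives [tau (sigma 1) = (sigma 1)^-1]. *)
Lemma sigma_symmetric_pivot G x y : sigma_symmetric sigma G -> G x y != 0 ->
  sigma_symmetric sigma (pivot sigma G x y).
Proof.
move=> Gsym Gxy.
have Gyx := sigma_symmetric_neq0 Gsym Gxy.
have nxy := edge_neq Gxy; have nyx := edge_neq Gyx.
have c0 := sesqui1_neq0.
case: sigmaP => _ sigmaK [tau _ tauE].
have sE a : sigma a = sigma 1 * tau a by rewrite tauE mulrC divfK.
have tc : tau (sigma 1) = (sigma 1)^-1 by rewrite tauE sigmaK mul1r.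
have tG s t : tau (G s t) = G t s / sigma 1 by rewrite tauE -Gsym.
move=> s t; rewrite sE /= /pivot_adj (eq_sym t s).
have [_|nst] := eqVneq s t; first by rewrite rmorph0 mulr0.
have [sx|sx] := eqVneq s x; have [sy|sy] := eqVneq s y;
  have [tx|tx] := eqVneq t x; have [ty|ty] := eqVneq t y;
  move: nxy nst; subst; rewrite ?eqxx //= => _ _;
  rewrite ?rmorphB ?rmorphN ?rmorphM ?fmorphV ?rmorphM ?rmorphXn ?rmorph1 ?tc ?tG;
  by field; rewrite ?Gxy ?Gyx ?c0.
Qed.

Lemma sigma_symmetric_pivots G p : sigma_symmetric sigma G ->
  pivots_defined sigma G p -> sigma_symmetric sigma (pivots sigma G p).
Proof.
elim: p G => [|[a b] p IHp] G //= Gsym /andP[Gab dp].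
exact: IHp (sigma_symmetric_pivot Gsym Gab) dp.
Qed.

Lemma rk_pivots G p A B : sigma_symmetric sigma G -> pivots_defined sigma G p ->
  [disjoint A & B] ->
  all (fun ab => (ab.1 \in A :|: B) && (ab.2 \in A :|: B)) p ->
  rk (pivots sigma G p) A B = rk G A B.
Proof.
move=> + + dAB.
elim: p G => [|[a b] p IHp] G //= Gsym /andP[Gab dp] /andP[/andP[aAB bAB] pAB].
rewrite IHp //; last exact: sigma_symmetric_pivot.
by rewrite rk_pivot ?sesqui1_neq0 // (sigma_symmetric_neq0 Gsym Gab).
Qed.

(* Tutte's linking argument: if neither deleting [v] nor pivoting at an edge [vw]
   and then deleting [v] preserves the connectivity between [X] and [Y], witnesses
   [Z1] and [Z2] of the two failures violate submodularity. *)
Lemma linking_pivots G X Y S k : sigma_symmetric sigma G ->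
  X \subset S -> Y \subset S -> [disjoint X & Y] ->
  (forall Z, X \subset Z -> Z \subset S :\: Y -> (k <= rk G Z (S :\: Z))%N) ->
  exists p, [/\ all (fun ab => (ab.1 \in ~: Y) && (ab.2 \in ~: Y)) p,
                pivots_defined sigma G p
              & (k <= rk (pivots sigma G p) X Y)%N].
Proof.
move=> Gsym XS YS dXY.
(* [G] is generalised because the induction may continue in a pivoted graph. *)
have [n] := ubnP #|S|; elim: n => // n IHn in G S Gsym XS YS *; rewrite ltnS => cS.
move=> link.
have [SXY|/subsetPn[v vS]] := boolP (S \subset X :|: Y).
  exists [::]; split=> //=.
  have -> : Y = S :\: X.
    apply/setP => z; have := subsetP SXY z; have := subsetP YS z.
    rewrite !inE; have [zX|_] := boolP (z \in X).
      by rewrite (disjointFr dXY zX).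
    by case: (z \in Y) => [->|_ /=] //; case: (z \in S) => // /(_ isT).
  by apply: link; rewrite // subsetD XS.
rewrite !inE negb_or => /andP[vX vY].
have cSv : (#|S :\ v| < n)%N by rewrite [#|S|](cardsD1 v) vS in cS.
have XSv : X \subset S :\ v by rewrite subsetD1 XS.
have YSv : Y \subset S :\ v by rewrite subsetD1 YS.
(* Either [v] can be deleted at once, or [Z1] is a cut of [S :\ v] of rank below [k]. *)
have [[Z1 /and3P[XZ1 Z1S rk1]]|del] :=
  altP (@existsP _ (fun Z => [&& X \subset Z, Z \subset S :\ v :\: Y
                              & (rk G Z (S :\ v :\: Z) < k)%N])); last first.
  apply: (IHn _ (S :\ v)) => // Z XZ ZS; rewrite leqNgt; apply/negP => rkZ.
  by case/existsP: del; exists Z; rewrite XZ ZS.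
have vZ1 : v \notin Z1.
  apply: contraTN Z1S => vZ; apply/subsetPn.
  by exists v; rewrite ?inE ?eqxx ?andbF.
have Z1SY : Z1 \subset S :\: Y.
  by apply: subset_trans Z1S _; rewrite setSD ?subD1set.
(* Taking [w] outside [Y] keeps the pivots off [Y]. Without such a neighbour, column [v] vanishes on
   the rows [Z1], so deleting [v] would not have lowered the rank of this cut. *)
have [/exists_inP[w /setDP[wS wY] Gvw]|noedge] :=
  boolP [exists w in S :\: Y, G v w != 0]; last first.
  suff : (k <= rk G Z1 (S :\ v :\: Z1))%N by rewrite leqNgt rk1.
  apply: leq_trans (link _ XZ1 Z1SY) _.
  rewrite /rk (_ : padmx G Z1 (S :\: Z1) = padmx G Z1 (S :\ v :\: Z1)) //.
  apply/matrixP => i j; rewrite !mxE !inE.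
  have [jv|] := eqVneq (enum_val j) v; last by [].
  rewrite /= !andbF; case: ifP => // /andP[iZ1 _]; rewrite jv; apply/eqP.
  apply: contraR noedge => Giv; apply/exists_inP; exists (enum_val i).
    exact: (subsetP Z1SY).
  exact: sigma_symmetric_neq0 Gsym Giv.
have Gwv := sigma_symmetric_neq0 Gsym Gvw.
have G'sym := sigma_symmetric_pivot Gsym Gvw.
have [|p [pY pdef prk]] := IHn _ _ G'sym XSv YSv cSv; last first.
  by exists ((v, w) :: p); split=> //=; rewrite ?pY ?inE ?vY ?wY //; apply/andP.
(* [Z2] is a cut of rank below [k] after pivoting at [vw] and deleting [v]. *)
move=> Z2 XZ2 Z2S; rewrite leqNgt; apply/negP => rk2.
have vZ2 : v \notin Z2.
  apply: contraTN Z2S => vZ; apply/subsetPn.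
  by exists v; rewrite ?inE ?eqxx ?andbF.
have Z2SY : Z2 \subset S :\: Y.
  by apply: subset_trans Z2S _; rewrite setSD ?subD1set.
(* Adding [v] to both sides of the second pair expresses its rank in [G] as one more than the
   pivoted rank of [Z2]. Since [v] is on neither side of the first pair, both resulting pairs
   partition [S], and [link] bounds them. *)
have := rk_submod G Z1 (S :\ v :\: Z1) (v |: Z2) (v |: (S :\ v :\: Z2)).
rewrite (rk_pivot_del sesqui1_neq0 Gvw Gwv); first last.
- by rewrite !inE wS andbT; case: (w \in Z2); rewrite //= eq_sym (edge_neq Gvw).
- by rewrite !inE eqxx (negPf vZ2).
- by rewrite -setI_eq0 setIDA setIC -setIDA setDv setI0.
have -> : (S :\ v :\: Z1) :|: (v |: (S :\ v :\: Z2)) = S :\: (Z1 :&: (v |: Z2)).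
  apply/setP => z; rewrite !inE; have [->|_] /= := eqVneq z v.
    by rewrite vS (negPf vZ1).
  by case: (z \in Z1); case: (z \in Z2); case: (z \in S).
have -> : (S :\ v :\: Z1) :&: (v |: (S :\ v :\: Z2)) = S :\: (Z1 :|: (v |: Z2)).
  apply/setP => z; rewrite !inE; have [->|_] /= := eqVneq z v.
    by rewrite andbF orbT.
  by case: (z \in Z1); case: (z \in Z2); case: (z \in S).
have cap : (k <= rk G (Z1 :&: (v |: Z2)) (S :\: (Z1 :&: (v |: Z2))))%N.
  apply: link.
    by rewrite subsetI XZ1 (subset_trans XZ2) ?subsetUr.
  by apply: subset_trans (subsetIl _ _) Z1SY.
have cup : (k <= rk G (Z1 :|: (v |: Z2)) (S :\: (Z1 :|: (v |: Z2))))%N.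
  apply: link; first by rewrite (subset_trans XZ1) ?subsetUl.
  by rewrite !subUset Z1SY Z2SY sub1set !inE vS vY.
(* The right-hand side is at most [(k - 1) + k], the left-hand side at least [k + k]. *)
move=> submod; have := leq_trans (leq_add cap cup) submod.
by rewrite leqNgt -addSn leq_add.
Qed.

End Sesqui.

(** * Cut-ranks expressed as block ranks *)

Section CutrankRank.

Variables (F : fieldType) (V : finType).
Implicit Types (G : star_graph F V) (A S : {set V}).

Lemma cutrkE G A : cutrk G A = rk G A (~: A).
Proof.
by rewrite /cutrk /adj_submx (@rk_imset _ _ _ id G) ?imset_id //; apply: inj_id.
Qed.

Lemma cutrk_inE G S A : A \subset S -> cutrk_in G S A = rk G A (S :\: A).
Proof.
move=> AS; rewrite /cutrk_in /cutrk /adj_submx (@rk_imset _ _ _ val G);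
  last exact: val_inj.
congr (rk _ _ _); apply/setP => v; apply/imsetP/idP.
- by case=> u; rewrite inE => uA ->.
- by move=> vA; exists (Sub v (subsetP AS v vA)); rewrite ?inE SubK.
- by case=> u; rewrite !inE => uA ->; rewrite uA (valP u).
- by case/setDP=> vS vA; exists (Sub v vS); rewrite ?inE SubK.
Qed.

End CutrankRank.

(** * Equivalence of the cut bound with the two pivot conditions *)

Theorem theorem3p4 (F : fieldType) (sigma : F -> F) (V : finType)
    (G : star_graph F V) (X Y : {set V}) (k : nat)
    (sigmaP : sesqui_morphism sigma) (Gsym : sigma_symmetric sigma G)
    (XYdisj : [disjoint X & Y])
    (rkX : cutrk G X = k) (rkY : cutrk G Y = k) :
  [<-> (k <= cutrk G [arg min_(Z < X | (X \subset Z) && (Z \subset ~: Y))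
                        cutrk G Z])%N;
       exists G' : star_graph F V,
         [/\ sigma_symmetric sigma G',
             pivot_equivalent sigma G' G,
             cutrk_in G' (X :|: Y) X = k
           & forall A B : {set V}, ~: Y \subset A -> B \subset ~: A ->
               cutrk_in G' (A :|: B) A = cutrk_in G (A :|: B) A];
       exists p : seq (V * V),
         [/\ all (fun ab => (ab.1 \in ~: Y) && (ab.2 \in ~: Y)) p,
             pivots_defined sigma G p
           & cutrk_in (pivots sigma G p) (X :|: Y) X = k]].
Proof.
have XY : X \subset ~: Y by rewrite -disjoints_subset.
have YX : Y \subset ~: X by rewrite subsetC.
have dC (A : {set V}) : [disjoint A & ~: A] by rewrite disjoints_subset setCK.
have subXY H : cutrk_in H (X :|: Y) X = rk H X Y.
  rewrite cutrk_inE ?subsetUl // setDUl setDv set0U; congr (rk _ _ _).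
  by apply/setDidPl; rewrite disjoint_sym.
have cutrk_pivots p (Z : {set V}) : pivots_defined sigma G p ->
    cutrk (pivots sigma G p) Z = cutrk G Z.
  move=> dp; rewrite !cutrkE (rk_pivots sigmaP) //.
  by apply/allP => ab _; rewrite setUCr !inE.
case: arg_minnP => [|Z0 /andP[XZ0 Z0Y] Z0min]; first by rewrite subxx.
have link : k <= cutrk G Z0 -> exists p : seq (V * V),
    [/\ all (fun ab => (ab.1 \in ~: Y) && (ab.2 \in ~: Y)) p,
        pivots_defined sigma G p
      & cutrk_in (pivots sigma G p) (X :|: Y) X = k].
  move=> kmin; have [Z XZ ZY|p [pY dp kp]] :=
    @linking_pivots _ _ _ sigmaP G X Y setT k Gsym (subsetT X) (subsetT Y) XYdisj.
    rewrite setTD -cutrkE; apply: leq_trans kmin (Z0min _ _).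
    by rewrite XZ -setTD.
  (* For the upper bound, the [X]-[Y] block lies in the cut of [X], whose rank [k] survives
     pivoting. *)
  exists p; split=> //; apply/eqP; rewrite subXY eqn_leq kp andbT.
  by rewrite -[leqRHS]rkX -(cutrk_pivots p) // cutrkE rkS.
(* As [X] lies in [Z0] and [Y] outside it, the [X]-[Y] block sits inside the cut of [Z0], whose rank
   no pivot changes. *)
have lower p : pivots_defined sigma G p ->
    cutrk_in (pivots sigma G p) (X :|: Y) X = k -> k <= cutrk G Z0.
  move=> dp <-; rewrite subXY -(cutrk_pivots p) // cutrkE rkS //.
  by rewrite subsetC.
tfae.
- case/link=> p [pY dp kp]; exists (pivots sigma G p); split=> //.
  + exact: sigma_symmetric_pivots.
  + by exists p.
  (* All pivoted vertices avoid [Y], hence lie in [A], so the rank between [A] and [B] is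
     preserved. *)
  + move=> A B YA BA; have AB : (A :|: B) :\: A = B.
      rewrite setDUl setDv set0U; apply/setDidPl.
      by rewrite disjoints_subset.
    rewrite !cutrk_inE ?subsetUl // AB (rk_pivots sigmaP) //.
      by rewrite disjoint_sym disjoints_subset.
    by apply: sub_all pY => ab /andP[aY bY]; rewrite !inE !(subsetP YA).
(* The given pivots may meet [Y], so they serve only to recover the cut bound, from which [link]
   produces a new sequence. *)
- by case=> G' [_ [p dp ->] kp _]; apply: link (lower p dp kp).
- by case=> p [_ dp kp]; apply: lower dp kp.
Qed.
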